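(* In the setting of the context, suppose the regularity assumption and the local worst-case oracle assumption hold, and fix $x\in\mathcal X$ (write $\ell_k(z)=\ell_k(x,z)$), $i\in[N]$, $1\le k_1<k_2\le K$ and $b\in\mathbb R_+$. Let $$\Psi_i^{(k_1,k_2)}(\alpha,\beta)=\max_{v_1,v_2}\Big\{\alpha_1\ell_{k_1}(\hat z_i+v_1)+\alpha_2\ell_{k_2}(\hat z_i+v_2): v_j\in\mathbb R^m,\ \hat z_i+v_j\in\mathcal Z,\ \alpha_jc(\hat z_i+v_j,\hat z_i)\le\beta_j,\ j\in\{1,2\}\Big\}$$ and $\Phi_i^{(k_1,k_2)}(\alpha)=\max\{\Psi_i^{(k_1,k_2)}(\alpha,\beta):\beta\in\mathbb R_+^2,\beta_1+\beta_2=b\}$. Then for any $\alpha,\alpha'\in\mathbb R_{++}^2$ with $\alpha_1+\alpha_2=\alpha_1'+\alpha_2'=1$, $$\Big|\Phi_i^{(k_1,k_2)}(\alpha)-\Phi_i^{(k_1,k_2)}(\alpha')\Big|\le\begin{cases}(R_i+2C_i)|\alpha_1-\alpha_1'|+2g\,b^r|\alpha_1-\alpha_1'|^{1-r}&\text{if }p=1,\\ R_i|\alpha_1-\alpha_1'|+2G_ib^{1/p}|\alpha_1-\alpha_1'|^{1-1/p}&\text{if }p>1,\end{cases}$$ where $R_i:=\max_{1\le k<k'\le K}|\ell_k(\hat z_i)-\ell_{k'}(\hat z_i)|$, $C_i:=\max_{k\in[K]}\{g+g\|\hat z_i-\hat z_0\|^r-\ell_k(\hat z_i)\}$, $G_i:=\max_{k\in[K]}\max\{\|\xi\|_*:\xi\in\partial\ell_k(\hat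 z_i)\}$, and $g,\hat z_0,r$ are the constant, reference point and exponent from part (iii) of the regularity assumption for the fixed $x$ (case $p=1$).
   Context: Notation: $[n]=\{1,\dots,n\}$; $\mathbb R_{++}$ is the set of positive reals; $\mathcal P(\mathcal Z)$ is the set of Borel probability measures on $\mathcal Z$; $\|\cdot\|_*$ is the dual norm of the norm $\|\cdot\|$ below; $\partial\ell_k(\hat z_i)$ is the superdifferential of the concave function $\ell_k$ at $\hat z_i$; $0^0=1$. Setting. $\mathcal X\subseteq\mathbb R^n$, $\mathcal Z\subseteq\mathbb R^m$. A transportation cost $c:\mathcal Z\times\mathcal Z\to\mathbb R_+$ is lower semicontinuous, satisfies $c(z,z)=0$ for all $z$, and $c(\cdot,\hat z)$ is convex for every fixed $\hat z\in\mathcal Z$. The optimal transport discrepancy is $\mathrm{OT}_c(\mathbb P,\mathbb Q)=\min_{\gamma}\mathbb E_{(z,\hat z)\sim\gamma}[c(z,\hat z)]$ over couplings $\gamma$ of $\mathbb P$ and $\mathbb Q$. Given $\hat z_1,\dots,\hat z_N\in\mathcal Z$, let $\hat{\mathbb P}=\frac1N\sum_{i=1}^N\delta_{\hat z_i}$; given $\rho>0$, let $\mathcal P=\{\mathbb P\in\mathcal P(\mathcal Z):\mathrm{OT}_c(\mathbb P,\hat{\mathbb P})\le\rho\}$. Regularity assumption. (i) $\mathcal X$ is nonempty and convex; there exist $\mathbb Q_0\in\mathcal P$ and $x_0\in\mathcal X$ such that $x\mapsto\mathbb E_{z\sim\mathbb Q_0}[\ell(x,z)]$ is inf-compact on $\mathcal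 X$ (all sublevel sets are compact) and $\mathbb E_{z\sim\mathbb Q_0}[\ell(x_0,z)]>-\infty$; $\mathcal Z$ is nonempty, closed and convex. (ii) $\ell(x,z)=\max_{k\in[K]}\ell_k(x,z)$ with $K\ge2$, where each $\ell_k:\mathbb R^n\times\mathbb R^m\to\mathbb R$ is real-valued, convex in its first and concave in its second argument. (iii) There exist a norm $\|\cdot\|$ on $\mathbb R^m$ and $p\ge1$ with $c(z,\hat z)\ge\|z-\hat z\|^p$ for all $z,\hat z\in\mathcal Z$; moreover, if $p=1$, then for every $x\in\mathcal X$ there exist $g>0$, $\hat z_0\in\mathcal Z$ and $r\in[0,1)$ such that $\ell(x,z)\le g[1+\|z-\hat z_0\|^r]$ for all $z\in\mathcal Z$. Local worst-case oracle assumption. For any $k\in[K]$, $\hat z\in\mathcal Z$, radius $u\ge0$ and accuracy $\epsilon>0$ there is an algorithm that returns $\hat v\in\mathbb R^m$ with $\hat z+\hat v\in\mathcal Z$, $c(\hat z+\hat v,\hat z)\le u$, together with $\hat L=\ell_k(\hat z+\hat v)\ge\max\{\ell_k(\hat z+v):v\in\mathbb R^m,\hat z+v\in\mathcal Z,c(\hat z+v,\hat z)\le u\}-\epsilon$. *)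

(* Defs.v *)
From HB Require Import structures.
From mathcomp Require Import all_boot all_order all_algebra.
From mathcomp Require Import all_classical all_reals all_analysis.

Set Implicit Arguments.
Unset Strict Implicit.
Unset Printing Implicit Defensive.

Import Order.TTheory GRing.Theory Num.Theory.
Import numFieldNormedType.Exports.

Local Open Scope classical_set_scope.
Local Open Scope ring_scope.

(* [maximum S] is the greatest element of S; it is 0 when S has none. *)
Definition is_maximum (R : realType) (S : set R) (t : R) : Prop :=
  S t /\ ubound S t.

Definition maximum (R : realType) (S : set R) : R := xget 0 (is_maximum S).

Lemma maximumE (R : realType) (S : set R) (t : R) :
  is_maximum S t -> maximum S = t.
Proof.
move=> [St ubt]; apply: xget_unique; first by split.
by move=> u [Su ubu]; apply/le_anti; rewrite ubt// ubu.
Qed.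

Section norms.
Variables (R : realType) (m : nat).
Implicit Types (nrm l : 'rV[R]_m -> R) (v w z xi : 'rV[R]_m).

Record is_norm nrm : Prop := {
  is_normD : forall v w, nrm (v + w) <= nrm v + nrm w ;
  is_normZ : forall (a : R) v, nrm (a *: v) = `|a| * nrm v ;
  is_norm_eq0 : forall v, nrm v = 0 -> v = 0 }.

Definition dotp v w : R := \sum_(j < m) v ord0 j * w ord0 j.

Definition dual_norm nrm xi : R :=
  sup [set dotp xi v | v in [set v | nrm v <= 1]].

Definition superdifferential l z : set 'rV[R]_m :=
  [set xi | forall w, l w <= l z + dotp xi (w - z)].

Definition concave_function l : Prop :=
  convex_function (E := 'rV[R]_m) setT (fun z => - l z).

End norms.

(* R^m with its Borel sigma-algebra *)
Definition borel_rV (R : realType) (m : nat) :=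
  g_sigma_algebraType (@open 'rV[R]_m).

Section transport.
Variables (R : realType) (m : nat).
Variables (Z : set 'rV[R]_m) (c : 'rV[R]_m -> 'rV[R]_m -> R).

(* c is a total function on R^m x R^m, but only its restriction to Z x Z is
   constrained, and only that restriction is ever used. *)
Record transport_cost : Prop := {
  cost_ge0 : forall z zh, Z z -> Z zh -> 0 <= c z zh ;
  cost_lsc : lower_semicontinuous
    (fun w : subspace (Z `*` Z) => (c w.1 w.2)%:E) ;
  cost_refl : forall z, Z z -> c z z = 0 ;
  cost_convex : forall zh, Z zh ->
    convex_function (E := 'rV[R]_m) Z (fun z => c z zh) }.

Definition coupling (P Q : set (borel_rV R m) -> \bar R)
    (gam : probability (borel_rV R m * borel_rV R m)%type R) : Prop :=
  forall A : set (borel_rV R m), measurable A ->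
    gam (A `*` setT) = P A /\ gam (setT `*` A) = Q A.

(* A Borel probability measure on the closed set Z is represented by a Borel
   probability measure on R^m giving mass 1 to Z; couplings of two such
   measures are concentrated on Z x Z. *)
Definition OT (P Q : set (borel_rV R m) -> \bar R) : \bar R :=
  ereal_inf [set (\int[gam]_(w in Z `*` Z) (c w.1 w.2)%:E)%E
            | gam in [set gam | coupling P Q gam]].

Definition empirical (N : nat) (zhat : 'I_N -> 'rV[R]_m)
    (A : set (borel_rV R m)) : \bar R :=
  ((N%:R^-1)%:E * \sum_(i < N) \d_(zhat i : borel_rV R m) A)%E.

Definition ambiguity_set (N : nat) (zhat : 'I_N -> 'rV[R]_m) (rho : R) :
    set (probability (borel_rV R m) R) :=
  [set P | P Z = 1%E /\ (OT P (empirical zhat) <= rho%:E)%E].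

End transport.

Section assumptions.
Variables (R : realType) (n m K N : nat).
Variables (X : set 'rV[R]_n) (Z : set 'rV[R]_m).
Variables (c : 'rV[R]_m -> 'rV[R]_m -> R).
Variables (ell : 'I_K -> 'rV[R]_n -> 'rV[R]_m -> R).

Definition loss (x : 'rV[R]_n) (z : 'rV[R]_m) : R :=
  maximum (range (fun k => ell k x z)).

Definition expected_loss (Q : probability (borel_rV R m) R)
    (x : 'rV[R]_n) : \bar R :=
  (\int[Q]_(z in Z) (loss x z)%:E)%E.

Definition inf_compact_on (f : 'rV[R]_n -> \bar R) : Prop :=
  forall a : R, compact [set x | X x /\ (f x <= a%:E)%E].

Definition growth_condition (nrm : 'rV[R]_m -> R) (x : 'rV[R]_n)
    (g : R) (z0 : 'rV[R]_m) (r : R) : Prop :=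
  [/\ 0 < g, Z z0, 0 <= r < 1 &
      forall z, Z z -> loss x z <= g * (1 + nrm (z - z0) `^ r)].

Record regularity (zhat : 'I_N -> 'rV[R]_m) (rho : R)
    (nrm : 'rV[R]_m -> R) (p : R) : Prop := {
  reg_X0 : X !=set0 ;
  reg_Xconvex : convex_set (X : set (convex_lmodType 'rV[R]_n)) ;
  reg_infcompact : exists Q0 x0,
    [/\ ambiguity_set Z c zhat rho Q0, X x0,
        inf_compact_on (expected_loss Q0) &
        (-oo < expected_loss Q0 x0)%E] ;
  reg_Z0 : Z !=set0 ;
  reg_Zclosed : closed Z ;
  reg_Zconvex : convex_set (Z : set (convex_lmodType 'rV[R]_m)) ;
  reg_K : (2 <= K)%N ;
  reg_convex : forall k z,
    convex_function (E := 'rV[R]_n) setT (fun x => ell k x z) ;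
  reg_concave : forall k x, concave_function (ell k x) ;
  reg_norm : is_norm nrm ;
  reg_p : 1 <= p ;
  reg_cost : forall z zh, Z z -> Z zh -> nrm (z - zh) `^ p <= c z zh ;
  reg_growth : p = 1 -> forall x, X x ->
    exists g z0 r, growth_condition nrm x g z0 r }.

End assumptions.

Section local_problems.
Variables (R : realType) (m K : nat).
Variables (Z : set 'rV[R]_m) (c : 'rV[R]_m -> 'rV[R]_m -> R).
(* l k is the function ell_k(x, .) for the fixed decision x. *)
Variable l : 'I_K -> 'rV[R]_m -> R.

(* The algorithm is modelled by its input-output map
   (k, zh, u, eps) |-> (vhat, Lhat). *)
Definition local_worst_case_oracle : Prop :=
  exists oracle : 'I_K -> 'rV[R]_m -> R -> R -> 'rV[R]_m * R,
  forall k zh u eps, Z zh -> 0 <= u -> 0 < eps ->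
    let: (vhat, Lhat) := oracle k zh u eps in
    [/\ Z (zh + vhat), c (zh + vhat) zh <= u, Lhat = l k (zh + vhat) &
        maximum [set l k (zh + v) |
                 v in [set v | Z (zh + v) /\ c (zh + v) zh <= u]] - eps
        <= Lhat].

Variable zi : 'rV[R]_m.

Definition Psi (k1 k2 : 'I_K) (alpha beta : R * R) : R :=
  maximum [set t | exists v1 v2 : 'rV[R]_m,
    [/\ Z (zi + v1) /\ Z (zi + v2),
        alpha.1 * c (zi + v1) zi <= beta.1,
        alpha.2 * c (zi + v2) zi <= beta.2 &
        t = alpha.1 * l k1 (zi + v1) + alpha.2 * l k2 (zi + v2)]].

Definition Phi (k1 k2 : 'I_K) (b : R) (alpha : R * R) : R :=
  maximum [set Psi k1 k2 alpha beta |
           beta in [set beta : R * R |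
                    [/\ 0 <= beta.1, 0 <= beta.2 & beta.1 + beta.2 = b]]].

Definition R_const : R :=
  maximum [set t | exists k k' : 'I_K,
                   (k < k')%N /\ t = `|l k zi - l k' zi|].

Definition C_const (nrm : 'rV[R]_m -> R) (g : R) (z0 : 'rV[R]_m) (r : R) : R :=
  maximum (range (fun k => g + g * nrm (zi - z0) `^ r - l k zi)).

Definition G_const (nrm : 'rV[R]_m -> R) : R :=
  maximum (range (fun k =>
    maximum [set dual_norm nrm xi | xi in superdifferential (l k) zi])).

End local_problems.

(* Main.v *)
Require Import Defs.
From HB Require Import structures.
From mathcomp Require Import all_boot all_order all_algebra.
From mathcomp Require Import all_classical all_reals all_analysis.
From mathcomp Require Import ring lra.

Set Implicit Arguments.
Unset Strict Implicit.
Unset Printing Implicit Defensive.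

Import Order.TTheory GRing.Theory Num.Theory.
Import numFieldNormedType.Exports.

Local Open Scope classical_set_scope.
Local Open Scope ring_scope.

(** Both maxima defining [Phi] are attained, because the feasible sets are
    compact (the cost is lower semicontinuous and dominates a power of a norm)
    and a finite concave function, having supergradients, is upper
    semicontinuous; hence [Phi alpha] is the maximum of
    [alpha_1 l_k1(z + v1) + alpha_2 l_k2(z + v2)] over the pairs with
    [alpha_1 c(z + v1, z) + alpha_2 c(z + v2, z) <= b]. Let [(v1, v2)] be optimal
    for [alpha], and let [j] be the index whose weight increases from [alpha] to
    [alpha']. Scaling [v_j] by [alpha_j / alpha'_j] keeps the pair feasible, by
    convexity of the cost, and by concavity the objective decreases by at most
    [d (l_k(z + v) - l_k'(z))], where [v] is the other displacement and [d] the
    weight it loses. As [d c(z + v, z) <= b], the norm of [v] is at most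
    [(b / d)^(1/p)], and [l_k(z + v) - l_k(z)] is then bounded by a supergradient
    if [p > 1] and by the growth condition if [p = 1]. *)

(** * Attained maxima *)

Section maxima.
Variable R : realType.

(** Since [maximum] is 0 on a set without a greatest element, attainment has to be shown before its
    value can be used. *)
Lemma maximumP (S : set R) :
  (exists t, is_maximum S t) -> is_maximum S (maximum S).
Proof. by move=> [t St]; rewrite (maximumE St). Qed.

Lemma is_maximum_image (T : Type) (A : set T) (f : T -> R) (a : T) :
  A a -> (forall y, A y -> f y <= f a) -> is_maximum (f @` A) (f a).
Proof. by move=> Aa fa; split; [exists a | move=> _ [y Ay <-]; exact: fa]. Qed.

Lemma fin_maximumP (I : finType) (f : I -> R) (i0 : I) :
  is_maximum (range f) (maximum (range f)).
Proof.
apply: maximumP.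
have [i _ fi] := arg_maxP f (erefl : xpredT i0).
by exists (f i); apply: is_maximum_image => // j _; exact: fi.
Qed.

End maxima.

(** * Upper semicontinuity and maxima on compact sets *)

Section upper_semicontinuity.
Variable R : realType.

(** Taken relative to [A], because the cost is constrained only on the product of [Z] with
    itself. *)
Definition usc_on (T : topologicalType) (A : set T) (f : T -> R) : Prop :=
  forall x, A x -> forall e, 0 < e ->
    \forall y \near within A (nbhs x), f y < f x + e.

Section theory.
Variable T : topologicalType.
Implicit Types (A B : set T) (f g : T -> R).

Lemma usc_onW A B f : A `<=` B -> usc_on B f -> usc_on A f.
Proof.
move=> AB uf x Ax e e0; have := uf x (AB _ Ax) e e0; rewrite !near_withinE.
by apply: filterS => y fy /AB /fy.
Qed.

Lemma usc_onD A f g : usc_on A f -> usc_on A g -> usc_on A (fun x => f x + g x).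
Proof.
move=> uf ug x Ax e e0.
have e20 : 0 < e / 2 by rewrite divr_gt0.
have := uf x Ax _ e20; have := ug x Ax _ e20.
by apply: filterS2 => y gy fy; lra.
Qed.

Lemma usc_onZ A f (k : R) : 0 < k -> usc_on A f -> usc_on A (fun x => k * f x).
Proof.
move=> k0 uf x Ax e e0; have := uf x Ax (e / k) (divr_gt0 e0 k0).
apply: filterS => y; rewrite -(ltr_pM2l k0) mulrDr mulrCA mulfV ?gt_eqF//.
by rewrite mulr1.
Qed.

Lemma continuous_usc_on A f : continuous f -> usc_on A f.
Proof.
move=> cf x Ax e e0.
have /cvgrPdist_lt/(_ _ e0) := cf x; rewrite near_withinE.
by apply: filterS => y fy _; move: fy; rewrite ltr_norml => /andP[]; lra.
Qed.

Lemma closed_usc_superlevel A f (t : R) :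
  closed A -> usc_on A f -> closed [set x | A x /\ t <= f x].
Proof.
move=> cA uf x clx.
have Ax : A x by apply: cA => V /clx [y [[Ay _] Vy]]; exists y.
split=> //; rewrite leNgt; apply/negP => fxt.
have e0 : 0 < t - f x by rewrite subr_gt0.
have /clx [y [[Ay ty] /(_ Ay)]] := uf x Ax _ e0.
by rewrite addrC subrK ltNge ty.
Qed.

(** The sets where [f] is at least [f s], for [s] in [A], generate a proper filter; at a cluster
    point, upper semicontinuity excludes a value below any [f y]. *)
Lemma usc_compact_max A f : A !=set0 -> compact A -> usc_on A f ->
  exists2 x, A x & forall y, A y -> f y <= f x.
Proof.
move=> [a Aa] cA uf.
pose F := filter_from A (fun s => [set x | A x /\ f s <= f x]).
have FF : ProperFilter F.
  apply: filter_from_proper => [|s As]; last by exists s.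
  apply: filter_from_filter; first by exists a.
  move=> i j Ai Aj; have [ij|/ltW ji] := leP (f i) (f j).
    by exists j => // x [Ax jx]; do 2?split => //; exact: le_trans jx.
  by exists i => // x [Ax jx]; do 2?split => //; exact: le_trans jx.
have [|x [Ax clx]] := cA F FF; first by exists a => // x [].
exists x => // y Ay; rewrite leNgt; apply/negP => fxy.
have e0 : 0 < f y - f x by rewrite subr_gt0.
have Fy : F [set x | A x /\ f y <= f x] by exists y.
have [z [[Az yz] /(_ Az)]] := clx _ _ Fy (uf x Ax _ e0).
by rewrite addrC subrK ltNge yz.
Qed.

End theory.

Lemma usc_on_comp (S T : topologicalType) (phi : S -> T) (A : set T)
    (f : T -> R) :
  continuous phi -> usc_on A f -> usc_on (phi @^-1` A) (f \o phi).
Proof. by move=> cphi uf x Ax e e0; exact: (cphi x _ (uf _ Ax e e0)). Qed.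

End upper_semicontinuity.

(** * Continuous pairs and the dot product *)

Lemma continuous_pair (S T U : topologicalType) (f : S -> T) (g : S -> U) :
  continuous f -> continuous g -> continuous (fun x => (f x, g x)).
Proof.
move=> cf cg x.
exact: (@cvg_pair _ _ _ (nbhs x) (nbhs (f x)) (nbhs (g x)) _ _ _ f g
  (cf x) (cg x)).
Qed.

Section dot_product.
Variables (R : realType) (m : nat).
Implicit Types u v w : 'rV[R]_m.

Lemma dotpDr u v w : dotp u (v + w) = dotp u v + dotp u w.
Proof.
by rewrite /dotp -big_split; apply: eq_bigr => j _; rewrite mxE mulrDr.
Qed.

Lemma dotpDl u v w : dotp (u + v) w = dotp u w + dotp v w.
Proof.
by rewrite /dotp -big_split; apply: eq_bigr => j _; rewrite mxE mulrDl.
Qed.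

Lemma dotpZr a u v : dotp u (a *: v) = a * dotp u v.
Proof. by rewrite /dotp mulr_sumr; apply: eq_bigr => j _; rewrite mxE mulrCA. Qed.

Lemma dotpZl a u v : dotp (a *: u) v = a * dotp u v.
Proof. by rewrite /dotp mulr_sumr; apply: eq_bigr => j _; rewrite mxE mulrA. Qed.

Lemma dotp0r u : dotp u 0 = 0.
Proof. by rewrite -(scale0r 0) dotpZr mul0r. Qed.

Lemma dotp_deltar u j : dotp u 'e_j = u ord0 j.
Proof.
rewrite /dotp (bigD1 j)//= big1 => [|k kj]; rewrite mxE.
  by rewrite !eqxx mulr1 addr0.
by rewrite (negbTE kj) andbF mulr0.
Qed.

Lemma dotp_deltal u j : dotp 'e_j u = u ord0 j.
Proof.
by rewrite -dotp_deltar; apply: eq_bigr => k _; rewrite mulrC.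
Qed.

Lemma continuous_dotp :
  continuous (fun w : 'rV[R]_m * 'rV[R]_m => dotp w.1 w.2).
Proof.
move=> w; apply: cvg_big => [|j _]; first exact: add_continuous.
apply: cvgM.
  by apply: (@cvg_comp _ _ _ fst (fun v : 'rV[R]_m => v ord0 j));
    [exact: cvg_fst | exact: coord_continuous].
by apply: (@cvg_comp _ _ _ snd (fun v : 'rV[R]_m => v ord0 j));
  [exact: cvg_snd | exact: coord_continuous].
Qed.

Lemma continuous_dotpl v : continuous (fun u => dotp u v).
Proof.
move=> u; apply: (@continuous_comp _ _ _ (fun u => (u, v))
  (fun w : 'rV[R]_m * 'rV[R]_m => dotp w.1 w.2)); last exact: continuous_dotp.
by apply: (@continuous_pair _ _ _ id (cst v)) => y;
  [exact: cvg_id|exact: cst_continuous].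
Qed.

Lemma continuous_dotpr u : continuous (dotp u).
Proof.
move=> v; apply: (@continuous_comp _ _ _ (fun v => (u, v))
  (fun w : 'rV[R]_m * 'rV[R]_m => dotp w.1 w.2)); last exact: continuous_dotp.
by apply: (@continuous_pair _ _ _ (cst u) id) => y;
  [exact: cst_continuous|exact: cvg_id].
Qed.

End dot_product.

(** * Norms in finite dimension and their duals *)

Section finite_dimensional_norms.
Variables (R : realType) (m : nat) (nrm : 'rV[R]_m -> R).
Hypothesis hn : is_norm nrm.
Implicit Types v w : 'rV[R]_m.

Lemma is_norm0 : nrm 0 = 0.
Proof. by rewrite -(scale0r 0) (is_normZ hn) normr0 mul0r. Qed.

Lemma is_normN v : nrm (- v) = nrm v.
Proof. by rewrite -scaleN1r (is_normZ hn) normrN1 mul1r. Qed.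

Lemma is_norm_ge0 v : 0 <= nrm v.
Proof.
have := is_normD hn v (- v); rewrite subrr is_norm0 is_normN.
by lra.
Qed.

Lemma is_norm_gt0 v : v != 0 -> 0 < nrm v.
Proof.
move=> v0; rewrite lt_neqAle is_norm_ge0 andbT eq_sym.
by apply: contra v0 => /eqP/(is_norm_eq0 hn) ->.
Qed.

Lemma coord_le_mx_norm v j : `|v ord0 j| <= `|v|.
Proof.
rewrite [leRHS]/Num.Def.normr /= mx_normrE.
exact: (le_bigmax _ (fun i : 'I_1 * 'I_m => `|v i.1 i.2|) (ord0, j)).
Qed.

Lemma is_norm_le_mx_norm : exists2 M, 0 <= M & forall v, nrm v <= M * `|v|.
Proof.
exists (\sum_(j < m) nrm 'e_j); first by apply: sumr_ge0 => j _; exact: is_norm_ge0.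
move=> v; rewrite {1}(row_sum_delta v) mulr_suml.
elim/big_ind2 : _ => [|a a' b b' h1 h2|j _]; first by rewrite is_norm0.
  by apply: le_trans (is_normD hn _ _) _; exact: lerD.
by rewrite (is_normZ hn) mulrC ler_wpM2l ?is_norm_ge0 ?coord_le_mx_norm.
Qed.

(** The triangle inequality makes [nrm] Lipschitz for the coordinatewise maximum norm. *)
Lemma continuous_is_norm : continuous nrm.
Proof.
have [M M0 nM] := is_norm_le_mx_norm.
have lip v w : nrm v - nrm w <= M * `|v - w|.
  by rewrite lerBlDr (le_trans _ (lerD (nM _) (lexx _)))// -{1}(subrK w v) (is_normD hn).
move=> v; apply/(@cvgrPdist_lt _ _ _ (nbhs v) (nbhs_filter v)) => e e0.
(* [M] may be 0, hence the denominator [M + 1]. *)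
have d0 : 0 < e / (M + 1) by rewrite divr_gt0// ltr_wpDl.
apply/nbhs_ballP; exists (e / (M + 1)) => //= w; rewrite -ball_normE /= => vw.
have Me : M * `|v - w| < e.
  move: vw; rewrite ltr_pdivlMr ?ltr_wpDl// => /(le_lt_trans _); apply.
  by rewrite mulrC ler_wpM2l// lerDl.
have := lip v w; have := lip w v; rewrite (distrC w) => h1 h2.
by rewrite ltr_norml; apply/andP; split; lra.
Qed.

Lemma compact_mx_sphere : compact [set v : 'rV[R]_m | `|v| = 1].
Proof.
apply: bounded_closed_compact; first by exists 1; split=> // M M1 v /= ->; exact: ltW.
apply: (@preimage_closed _ _ (fun v : 'rV[R]_m => `|v|) [set 1]).
  by move=> v _; exact: norm_continuous.
exact: (@closed_eq R 1).
Qed.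

(** On the compact unit sphere of the maximum norm, [nrm] has a positive minimum; homogeneity does
    the rest. *)
Lemma mx_norm_le_is_norm : exists2 C, 0 < C & forall v, `|v| <= C * nrm v.
Proof.
have [S0|S0] := pselect ([set v : 'rV[R]_m | `|v| = 1] !=set0); last first.
  (* An empty sphere forces every vector to be 0 (the case [m = 0]), so any constant serves. *)
  exists 1 => // v; have [->|v0] := eqVneq v 0; first by rewrite normr0 is_norm0 mulr0.
  case: S0; exists (`|v|^-1 *: v); rewrite /= normrZ ger0_norm ?invr_ge0//.
  by rewrite mulVf ?normr_eq0.
have [|u u1 umin] := usc_compact_max S0 compact_mx_sphere (f := fun v => - nrm v).
  apply: continuous_usc_on => v.
  exact: (continuousN (continuous_is_norm (x := v))).
have nu : 0 < nrm u by rewrite is_norm_gt0// -normr_eq0 u1 oner_eq0.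
exists (nrm u)^-1; rewrite ?invr_gt0// => v.
have [->|v0] := eqVneq v 0; first by rewrite normr0 is_norm0 mulr0.
have /umin : `| `|v|^-1 *: v| = 1.
  by rewrite normrZ ger0_norm ?invr_ge0// mulVf ?normr_eq0.
rewrite lerN2 (is_normZ hn) ger0_norm ?invr_ge0// => h.
rewrite ler_pdivlMl// -ler_pdivlMr ?normr_gt0//.
by rewrite mulrC.
Qed.

Lemma compact_is_norm_ball (u : R) : compact [set v | nrm v <= u].
Proof.
have [C C0 CP] := mx_norm_le_is_norm.
apply: bounded_closed_compact.
  exists (C * u); split; first exact: num_real.
  move=> M CM v /= vu; apply: le_trans (CP v) _; apply: le_trans (ltW CM).
  by rewrite ler_pM2l.
apply: (@preimage_closed _ _ nrm [set x | x <= u]).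
  by move=> v _; exact: continuous_is_norm.
exact: closed_le.
Qed.

(** A linear form is bounded on the compact unit ball, so the [sup] in [dual_norm] is a true
    supremum. *)
Lemma has_sup_dual_norm (xi : 'rV[R]_m) :
  has_sup [set dotp xi v | v in [set v | nrm v <= 1]].
Proof.
split; first by exists (dotp xi 0); exists 0; rewrite //= is_norm0.
have B0 : [set v | nrm v <= 1] !=set0 by exists 0; rewrite /= is_norm0.
have [|u _ umax] := usc_compact_max (f := dotp xi) B0 (@compact_is_norm_ball 1).
  by apply: continuous_usc_on; exact: continuous_dotpr.
by exists (dotp xi u) => _ [v v1 <-]; exact: umax.
Qed.

Lemma dual_norm_ge0 (xi : 'rV[R]_m) : 0 <= dual_norm nrm xi.
Proof.
apply: sup_upper_bound; first exact: has_sup_dual_norm.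
by exists 0; rewrite ?dotp0r//= is_norm0.
Qed.

Lemma dotp_le_dual_norm (xi v : 'rV[R]_m) :
  dotp xi v <= dual_norm nrm xi * nrm v.
Proof.
have [->|v0] := eqVneq v 0; first by rewrite dotp0r is_norm0 mulr0.
have nv := is_norm_gt0 v0.
rewrite -ler_pdivrMr// mulrC -dotpZr.
apply: sup_upper_bound; first exact: has_sup_dual_norm.
exists ((nrm v)^-1 *: v) => //=.
by rewrite (is_normZ hn) ger0_norm ?invr_ge0 ?is_norm_ge0// mulVf ?gt_eqF.
Qed.

End finite_dimensional_norms.

(** * Supergradients of concave functions *)

Section supergradients.
Variables (R : realType) (m : nat).
Implicit Types (l : 'rV[R]_m -> R) (z v w : 'rV[R]_m).

Lemma convex_functionP (D : set 'rV[R]_m) (f : 'rV[R]_m -> R) v w (t : R) :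
  convex_function (E := 'rV[R]_m) D f -> D v -> D w -> 0 <= t <= 1 ->
  f (t *: v + (1 - t) *: w) <= t * f v + (1 - t) * f w.
Proof.
move=> cf Dv Dw t01.
exact: (cf (Itv01 (andP t01).1 (andP t01).2) v w (mem_set Dv) (mem_set Dw)).
Qed.

Lemma convex_setP (D : set 'rV[R]_m) v w (t : R) :
  convex_set (D : set (convex_lmodType 'rV[R]_m)) -> D v -> D w ->
  0 <= t <= 1 -> D (t *: v + (1 - t) *: w).
Proof.
move=> cD Dv Dw t01; apply: set_mem.
exact: (cD v w (Itv01 (andP t01).1 (andP t01).2) (mem_set Dv) (mem_set Dw)).
Qed.

Lemma concave_functionP l v w (t : R) : concave_function l -> 0 <= t <= 1 ->
  t * l v + (1 - t) * l w <= l (t *: v + (1 - t) *: w).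
Proof.
move=> cl t01.
have := @convex_functionP setT (fun z => - l z) v w t cl I I t01.
by rewrite !mulrN -opprD lerN2.
Qed.

(* One step of the Hahn-Banach extension: the slope [t] separates the
   difference quotients of [l] along [e] from those along [-e]. *)
Lemma supergradient_extend l z (W : set 'rV[R]_m) (xi e : 'rV[R]_m) :
  concave_function l -> W 0 ->
  (forall v w (t : R), W v -> W w -> 0 <= t <= 1 ->
     W (t *: v + (1 - t) *: w)) ->
  (forall w, W w -> l (z + w) <= l z + dotp xi w) ->
  exists t, forall w s, W w -> l (z + w + s *: e) <= l z + dotp xi w + s * t.
Proof.
move=> cl W0 cW hxi.
have key w w' s s' : W w -> W w' -> 0 < s -> 0 < s' ->
    (l (z + w + s *: e) - l z - dotp xi w) / s <=
    (l z + dotp xi w' - l (z + w' - s' *: e)) / s'.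
  move=> Ww Ww' s0 s'0.
  have ss : 0 < s + s' by rewrite addr_gt0.
  have ssn : s + s' != 0 by rewrite gt_eqF.
  (* This weight cancels the components along [e] in the convex combination:
     [t * s = (1 - t) * s']. *)
  set t := s' / (s + s').
  have t01 : 0 <= t <= 1.
    apply/andP; split; first by rewrite divr_ge0 ?(ltW s'0) ?(ltW ss).
    by rewrite ler_pdivrMr// mul1r lerDr ltW.
  have := concave_functionP (z + w + s *: e) (z + w' - s' *: e) cl t01.
  have -> : t *: (z + w + s *: e) + (1 - t) *: (z + w' - s' *: e) =
            z + (t *: w + (1 - t) *: w').
    apply/rowP => j; rewrite !mxE /t; field.
    exact: ssn.
  move/le_trans/(_ (hxi _ (cW _ _ _ Ww Ww' t01))).
  rewrite dotpDr !dotpZr => h.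
  rewrite ler_pdivlMr// mulrAC ler_pdivrMr//.
  have t1 : t * (s + s') = s' by rewrite /t mulfVK.
  have : (t * l (z + w + s *: e) + (1 - t) * l (z + w' - s' *: e)) * (s + s')
     <= (l z + (t * dotp xi w + (1 - t) * dotp xi w')) * (s + s').
    by rewrite ler_pM2r.
  have E1 (a b : R) : (t * a + (1 - t) * b) * (s + s') = s' * a + s * b.
    by rewrite -[in RHS]t1 /t; field.
  by rewrite E1 mulrDl E1; lra.
pose S := [set x | exists w s, [/\ W w, 0 < s &
  x = (l (z + w + s *: e) - l z - dotp xi w) / s]].
have hS : has_sup S.
  split; first by eexists; exists 0, 1; split.
  exists ((l z + dotp xi 0 - l (z + 0 - 1 *: e)) / 1).
  by move=> _ [w [s [Ww s0 ->]]]; exact: key.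
exists (sup S) => w s Ww; have [s0|s0|->] := ltgtP s 0.
- have s'0 : 0 < - s by rewrite oppr_gt0.
  have : sup S <= (l z + dotp xi w - l (z + w - (- s) *: e)) / (- s).
    apply: ge_sup => [|_ [w' [s' [Ww' s'0' ->]]]]; first by case: hS.
    exact: key.
  by rewrite ler_pdivlMr// scaleNr opprK; lra.
- have : (l (z + w + s *: e) - l z - dotp xi w) / s <= sup S.
    by apply: sup_upper_bound => //; exists w, s.
  by rewrite ler_pdivrMr//; lra.
- by rewrite scale0r addr0 mul0r addr0; exact: hxi.
Qed.

(** A supergradient on the zero subspace is extended one coordinate direction at a time: [W 0]
    contains only 0 and [W m] is the whole space. *)
Lemma superdifferential_nonempty l z :
  concave_function l -> superdifferential l z !=set0.
Proof.
move=> cl.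
pose W (j : nat) : set 'rV[R]_m :=
  [set w | forall k : 'I_m, (j <= k)%N -> w ord0 k = 0].
suff /(_ m (leqnn m))[xi xiP] : forall j, (j <= m)%N ->
    exists xi, forall w, W j w -> l (z + w) <= l z + dotp xi w.
  exists xi => w; rewrite -{1}(subrK z w) addrC; apply: xiP => k.
  by rewrite leqNgt ltn_ord.
elim=> [_|j IH jm].
  exists 0 => w Ww; have -> : w = 0 by apply/rowP => k; rewrite Ww// mxE.
  by rewrite dotp0r !addr0.
have [xi xiP] := IH (ltnW jm).
pose o := Ordinal jm.
have [||t tP] := @supergradient_extend l z (W j) xi 'e_o cl _ _ xiP.
- by move=> k _; rewrite mxE.
- by move=> v w t Wv Ww _ k jk; rewrite !mxE Wv// Ww// !mulr0 addr0.
(* Only coordinate [o] changes: it becomes [t], the slope found along ['e_o]. *)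
exists (xi + (t - xi ord0 o) *: 'e_o) => w Ww.
have := tP (w - w ord0 o *: 'e_o) (w ord0 o).
rewrite addrA subrK dotpDl dotpZl dotp_deltal dotpDr -scaleNr dotpZr dotp_deltar.
move=> h; apply: le_trans (h _) _.
  move=> k jk; rewrite !mxE eqxx /=.
  have [->|ko] := eqVneq k o; first by rewrite mulr1 subrr.
  rewrite mulr0 addr0 Ww// ltn_neqAle jk andbT.
  by apply: contra ko => /eqP jk'; apply/eqP/val_inj.
by lra.
Qed.

(** A supergradient at [z] gives a continuous affine majorant of [l] that agrees with [l] at [z]. *)
Lemma concave_usc l (A : set 'rV[R]_m) : concave_function l -> usc_on A l.
Proof.
move=> cl z Az e e0.
have [xi xiP] := superdifferential_nonempty z cl.
have cd : continuous (dotp xi) := @continuous_dotpr _ _ xi.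
have := continuous_usc_on (A := A) cd Az e0.
apply: filterS => w hw; apply: le_lt_trans (xiP w) _.
by rewrite ltrD2l dotpDr -scaleN1r dotpZr; lra.
Qed.

(** An intersection of closed half-spaces; testing at [z + 'e_j] and [z - 'e_j] confines coordinate
    [j] to a segment. *)
Lemma superdifferential_compact l z : compact (superdifferential l z).
Proof.
have cbox := @rV_compact R m
  (fun j => `[l (z + 'e_j) - l z, l z - l (z - 'e_j)]%classic)
  (fun j => @segment_compact _ (l (z + 'e_j) - l z) (l z - l (z - 'e_j))).
apply: subclosed_compact cbox _.
  have -> : superdifferential l z =
      \bigcap_w (fun xi => dotp xi (w - z)) @^-1` [set y | l w - l z <= y].
    apply/seteqP; split => xi h w; first by move=> _ /=; have := h w; lra.
    by have /= := h w I; lra.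
  apply: closed_bigI => w _; apply: preimage_closed.
    by move=> xi _; exact: continuous_dotpl.
  exact: closed_ge.
move=> xi h j /=; rewrite in_itv /=.
have := h (z + 'e_j); have := h (z - 'e_j).
have zK u : z + u - z = u by rewrite addrAC subrr add0r.
rewrite !zK -scaleN1r dotpZr dotp_deltar.
by move=> h1 h2; apply/andP; split; lra.
Qed.

(** Maximising [dotp xi v] jointly over the compact product of the superdifferential and the unit
    ball yields a [xi] of largest dual norm, without going through continuity of the dual norm. *)
Lemma superdifferential_dual_norm_max nrm l z :
  is_norm nrm -> concave_function l ->
  exists t, is_maximum [set dual_norm nrm xi | xi in superdifferential l z] t.
Proof.
move=> hn cl.
have [xi0 xi0P] := superdifferential_nonempty z cl.
pose A := superdifferential l z `*` [set v | nrm v <= 1].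
have A0 : A !=set0 by exists (xi0, 0); split; rewrite //= is_norm0.
have cA : compact A.
  by apply: compact_setX; [exact: superdifferential_compact|exact: compact_is_norm_ball].
have [|[xi v] [/= xiP v1] maxP] := usc_compact_max
  (f := fun w : 'rV[R]_m * 'rV[R]_m => dotp w.1 w.2) A0 cA.
  by apply: continuous_usc_on; exact: continuous_dotp.
exists (dual_norm nrm xi); apply: is_maximum_image => // xi' xi'P.
apply: (@le_trans _ _ (dotp xi v)).
  apply: ge_sup => [|_ [v' v'1 <-]]; last exact: (maxP (xi', v')).
  by have [] := has_sup_dual_norm hn xi'.
by apply: sup_upper_bound; [exact: has_sup_dual_norm|exists v].
Qed.

(** A supergradient of largest dual norm bounds the increment of [l k] linearly, and that dual norm
    is at most the maximum over all [k]. *)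
Lemma G_constP K (l : 'I_K -> 'rV[R]_m -> R) nrm z (k : 'I_K) :
  is_norm nrm -> (forall k, concave_function (l k)) ->
  0 <= G_const l z nrm /\
  forall v, l k (z + v) - l k z <= G_const l z nrm * nrm v.
Proof.
move=> hn cl.
pose G k := maximum [set dual_norm nrm xi | xi in superdifferential (l k) z].
have GP k' := maximumP (superdifferential_dual_norm_max z hn (cl k')).
have Gk : G k <= G_const l z nrm.
  by have [_] := fin_maximumP G k; apply; exists k.
have [[xi xiP xiE] _] := GP k; rewrite -/(G k) in xiE.
have xiG : dual_norm nrm xi <= G_const l z nrm by rewrite xiE.
split=> [|v]; first by apply: le_trans xiG; exact: dual_norm_ge0.
have := xiP (z + v); rewrite addrAC subrr add0r -lerBlDl => /le_trans; apply.
apply: le_trans (dotp_le_dual_norm hn _ _) _.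
by rewrite ler_wpM2r// is_norm_ge0.
Qed.

End supergradients.

(** * Attainment in the local problems *)

Section local_problem.
Variables (R : realType) (m K : nat).
Variables (Z : set 'rV[R]_m) (c : 'rV[R]_m -> 'rV[R]_m -> R).
Variables (l : 'I_K -> 'rV[R]_m -> R) (nrm : 'rV[R]_m -> R) (p : R).
Variable zi : 'rV[R]_m.
Hypothesis hc : transport_cost Z c.
Hypothesis hn : is_norm nrm.
Hypothesis p_ge1 : 1 <= p.
Hypothesis Zclosed : closed Z.
Hypothesis Zconvex : convex_set (Z : set (convex_lmodType 'rV[R]_m)).
Hypothesis hl : forall k, concave_function (l k).
Hypothesis cost_ge : forall z zh, Z z -> Z zh -> nrm (z - zh) `^ p <= c z zh.
Hypothesis Zzi : Z zi.

Local Notation pairs := [set w : 'rV[R]_m * 'rV[R]_m |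
  Z (zi + w.1) /\ Z (zi + w.2)].

Lemma norm_le_cost v (u : R) : 0 <= u -> Z (zi + v) -> c (zi + v) zi <= u ->
  nrm v <= u `^ p^-1.
Proof.
move=> u0 Zv cu; have p0 : 0 < p by apply: lt_le_trans p_ge1.
have := le_trans (cost_ge Zv Zzi) cu; rewrite addrAC subrr add0r => h.
have h' : (nrm v `^ p) `^ p^-1 <= u `^ p^-1.
  by apply: ge0_ler_powR; rewrite ?nnegrE ?invr_ge0 ?powR_ge0// ltW.
by move: h'; rewrite -powRrM mulfV ?gt_eqF// powRr1// (is_norm_ge0 hn).
Qed.

(** Lower semicontinuity of the cost is pulled back along [w |-> (zi + phi w, zi)]; the intended
    [phi] are the two projections. *)
Lemma usc_on_cost (phi : 'rV[R]_m * 'rV[R]_m -> 'rV[R]_m) :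
  continuous phi -> (forall w, pairs w -> Z (zi + phi w)) ->
  usc_on pairs (fun w => - c (zi + phi w) zi).
Proof.
move=> cphi phiZ.
have u0 : usc_on (Z `*` Z) (fun w => - c w.1 w.2).
  move=> w Zw e e0.
  have [|V] := cost_lsc hc (x := w) (a := c w.1 w.2 - e).
    by rewrite lte_fin gtrBl.
  rewrite /nbhs /= -nbhs_subspace_in// => nV VP.
  apply: filterS nV => y /VP; rewrite /= lte_fin; lra.
have cpsi : continuous (fun w => (zi + phi w, zi)).
  apply: continuous_pair => w; last exact: cst_continuous.
  by apply: cvgD; [exact: cst_continuous|exact: cphi].
apply: (@usc_onW _ _ _ ((fun w => (zi + phi w, zi)) @^-1` (Z `*` Z))).
  by move=> w Zw; split=> //=; exact: phiZ.
exact: (usc_on_comp cpsi u0).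
Qed.

Lemma closed_pairs : closed pairs.
Proof.
have -> : pairs = (fun w => zi + w.1) @^-1` Z `&` (fun w => zi + w.2) @^-1` Z.
  by [].
apply: closedI; apply: preimage_closed => // w _.
  by apply: cvgD; [exact: cst_continuous|exact: cvg_fst].
by apply: cvgD; [exact: cst_continuous|exact: cvg_snd].
Qed.

Lemma usc_on_objective (a : R * R) k1 k2 : 0 < a.1 -> 0 < a.2 ->
  usc_on pairs (fun w => a.1 * l k1 (zi + w.1) + a.2 * l k2 (zi + w.2)).
Proof.
move=> a1 a2.
have us k (phi : 'rV[R]_m * 'rV[R]_m -> 'rV[R]_m) : continuous phi ->
    usc_on pairs (fun w => l k (zi + phi w)).
  move=> cphi; apply: (@usc_onW _ _ _ ((fun w => zi + phi w) @^-1` setT)) => //.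
  apply: usc_on_comp; last exact: concave_usc.
  by move=> w; apply: cvgD; [exact: cst_continuous|exact: cphi].
apply: usc_onD; apply: usc_onZ => //; apply: us => w.
- exact: cvg_fst.
- exact: cvg_snd.
Qed.

(** Here [a] stands for a positive lower bound of both weights; both displacements then lie in the
    norm ball of radius $(b/a)^{1/p}$. *)
Lemma compact_feasible (a b : R) (F : set ('rV[R]_m * 'rV[R]_m)) : 0 < a ->
  closed F ->
  (forall w, F w -> [/\ pairs w, a * c (zi + w.1) zi <= b
                      & a * c (zi + w.2) zi <= b]) ->
  compact F.
Proof.
move=> a0 cF FP.
have p0 : 0 <= p^-1 by rewrite invr_ge0; apply: le_trans p_ge1.
have cB := @compact_is_norm_ball _ _ _ hn ((b / a) `^ p^-1).
apply: subclosed_compact cF (compact_setX cB cB) _.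
move=> w /FP[[Z1 Z2]]; rewrite mulrC -ler_pdivlMr// => c1.
rewrite mulrC -ler_pdivlMr// => c2.
have b0 : 0 <= b / a by apply: le_trans c1; exact: (cost_ge0 hc).
by split; apply: norm_le_cost.
Qed.

(* The budget split [beta] is eliminated by taking
   [beta.1 = a.1 * c (zi + w.1) zi]. *)
Lemma Phi_attained k1 k2 (b : R) (a : R * R) : 0 <= b -> 0 < a.1 -> 0 < a.2 ->
  (exists w, [/\ pairs w,
     a.1 * c (zi + w.1) zi + a.2 * c (zi + w.2) zi <= b &
     Phi Z c l zi k1 k2 b a =
       a.1 * l k1 (zi + w.1) + a.2 * l k2 (zi + w.2)]) /\
  (forall w, pairs w ->
     a.1 * c (zi + w.1) zi + a.2 * c (zi + w.2) zi <= b ->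
     a.1 * l k1 (zi + w.1) + a.2 * l k2 (zi + w.2) <= Phi Z c l zi k1 k2 b a).
Proof.
move=> b0 a1 a2.
set f := fun w : 'rV[R]_m * 'rV[R]_m =>
  a.1 * l k1 (zi + w.1) + a.2 * l k2 (zi + w.2).
have uf : usc_on pairs f by exact: usc_on_objective.
have czi : c zi zi = 0 := cost_refl hc Zzi.
have cge w : pairs w -> 0 <= c (zi + w.1) zi /\ 0 <= c (zi + w.2) zi.
  by move=> [? ?]; split; exact: (cost_ge0 hc).
have uc1 : usc_on pairs (fun w => a.1 * - c (zi + w.1) zi).
  by apply: usc_onZ => //; apply: usc_on_cost => [w|w []//]; exact: cvg_fst.
have uc2 : usc_on pairs (fun w => a.2 * - c (zi + w.2) zi).
  by apply: usc_onZ => //; apply: usc_on_cost => [w|w []//]; exact: cvg_snd.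
pose mn := Num.min a.1 a.2.
have mn0 : 0 < mn by rewrite lt_min a1.
have mn1 : mn <= a.1 by rewrite ge_min lexx.
have mn2 : mn <= a.2 by rewrite ge_min lexx orbT.
have p00 : pairs (0, 0) by split; rewrite /= addr0.
have PsiP beta : 0 <= beta.1 -> 0 <= beta.2 -> exists2 w,
    [/\ pairs w, a.1 * c (zi + w.1) zi <= beta.1
      & a.2 * c (zi + w.2) zi <= beta.2] &
    Psi Z c l zi k1 k2 a beta = f w /\
    forall w', pairs w' -> a.1 * c (zi + w'.1) zi <= beta.1 ->
      a.2 * c (zi + w'.2) zi <= beta.2 -> f w' <= f w.
  move=> be1 be2.
  pose F := [set w | pairs w /\ - beta.1 <= a.1 * - c (zi + w.1) zi] `&`
            [set w | pairs w /\ - beta.2 <= a.2 * - c (zi + w.2) zi].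
  have FE w : F w <-> [/\ pairs w, a.1 * c (zi + w.1) zi <= beta.1
      & a.2 * c (zi + w.2) zi <= beta.2].
    rewrite /F /= !mulrN !lerN2.
    by split=> [[[? ?] [? ?]]|[? ? ?]]; split.
  have cF : compact F.
    apply: (compact_feasible (b := beta.1 + beta.2) mn0).
      by apply: closedI; apply: closed_usc_superlevel => //; exact: closed_pairs.
    move=> w /FE [pw c1 c2]; have [g1 g2] := cge w pw; split => //.
      apply: (@le_trans _ _ (a.1 * c (zi + w.1) zi)); last by lra.
      by rewrite ler_wpM2r.
    apply: (@le_trans _ _ (a.2 * c (zi + w.2) zi)); last by lra.
    by rewrite ler_wpM2r.
  have [||w /FE wF wmax] := usc_compact_max (f := f) _ cF.
  - by exists (0, 0); apply/FE; split; rewrite //= addr0 czi mulr0.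
  - by apply: usc_onW uf => w /FE[].
  exists w => //; split; last by move=> w' ? ? ?; apply: wmax; exact/FE.
  apply: maximumE; case: wF => -[Z1 Z2] c1 c2; split.
    by exists w.1, w.2; split.
  move=> _ [v1 [v2 [[Zv1 Zv2] cv1 cv2 ->]]].
  by apply: (wmax (v1, v2)); apply/FE.
pose F := [set w | pairs w /\
  - b <= a.1 * - c (zi + w.1) zi + a.2 * - c (zi + w.2) zi].
have FE w : F w <-> pairs w /\
    a.1 * c (zi + w.1) zi + a.2 * c (zi + w.2) zi <= b.
  by rewrite /F /= !mulrN -opprD lerN2.
have cF : compact F.
  apply: (compact_feasible (b := b) mn0).
    by apply: closed_usc_superlevel; [exact: closed_pairs|exact: usc_onD].
  move=> w /FE [pw c1]; have [g1 g2] := cge w pw.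
  have h1 : mn * c (zi + w.1) zi <= a.1 * c (zi + w.1) zi by rewrite ler_wpM2r.
  have h2 : mn * c (zi + w.2) zi <= a.2 * c (zi + w.2) zi by rewrite ler_wpM2r.
  have g1' := mulr_ge0 (ltW a1) g1; have g2' := mulr_ge0 (ltW a2) g2.
  by split => //; lra.
have [||w /FE [pw cw] wmax] := usc_compact_max (f := f) _ cF.
- by exists (0, 0); apply/FE; split; rewrite //= addr0 czi !mulr0 addr0.
- by apply: usc_onW uf => w /FE[].
have -> : Phi Z c l zi k1 k2 b a = f w.
  apply: maximumE; have [g1 g2] := cge w pw.
  have g1' := mulr_ge0 (ltW a1) g1; have g2' := mulr_ge0 (ltW a2) g2.
  split.
    exists (a.1 * c (zi + w.1) zi, b - a.1 * c (zi + w.1) zi).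
      by split => /=; lra.
    (* For this split the inner maximum is [f w]: its maximiser obeys the joint budget, and [w]
       obeys the split. *)
    have [||w' [pw' c1 c2] [-> w'max]] :=
      PsiP (a.1 * c (zi + w.1) zi, b - a.1 * c (zi + w.1) zi).
    + by [].
    + by rewrite /=; lra.
    apply/eqP; rewrite eq_le; apply/andP; split.
      by apply: wmax; apply/FE; split=> //; move: c1 c2 => /=; lra.
    by apply: w'max => //=; lra.
  move=> _ [beta [be1 be2 beb] <-].
  have [w' [pw' c1 c2] [-> _]] := PsiP beta be1 be2.
  by apply: wmax; apply/FE; split=> //; lra.
split; first by exists w.
by move=> w' pw' cw'; apply: wmax; apply/FE.
Qed.

(** * Comparison of two weight vectors *)

(** Scaling [v] by [a / a'] moves [zi + v] towards [zi], where the cost is 0; convexity of the cost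
    and concavity of [l k], multiplied by [a'], give the two bounds. *)
Lemma rescale_displacement k (a a' : R) v : 0 < a -> a <= a' -> Z (zi + v) ->
  exists v', [/\ Z (zi + v'), a' * c (zi + v') zi <= a * c (zi + v) zi &
    a * l k (zi + v) + (a' - a) * l k zi <= a' * l k (zi + v')].
Proof.
move=> a0 aa' Zv; have a'0 : 0 < a' := lt_le_trans a0 aa'.
pose t := a / a'.
have t01 : 0 <= t <= 1.
  apply/andP; split; first by rewrite divr_ge0 ?(ltW a0) ?(ltW a'0).
  by rewrite ler_pdivrMr// mul1r.
have ta : a' * t = a by rewrite /t mulrC divfK// gt_eqF.
clearbody t.
have E : zi + t *: v = t *: (zi + v) + (1 - t) *: zi.
  by apply/rowP => j; rewrite !mxE; ring.
exists (t *: v); rewrite E; split.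
- exact: convex_setP.
- have h := convex_functionP (cost_convex hc Zzi) Zv Zzi t01.
  by rewrite (cost_refl hc Zzi) mulr0 addr0 -(ler_pM2l a'0) mulrA ta in h.
- have t1a : a' * (1 - t) = a' - a by rewrite mulrBr mulr1 ta.
  have h := concave_functionP (zi + v) zi (hl k) t01.
  by rewrite -(ler_pM2l a'0) mulrDr !mulrA ta t1a in h.
Qed.

Lemma R_constP k k' : k != k' -> `|l k zi - l k' zi| <= R_const l zi.
Proof.
move=> kk'.
(* Pairs that are not increasing get the default 0, which is at most every absolute value. *)
pose f (q : 'I_K * 'I_K) :=
  if (q.1 < q.2)%N then `|l q.1 zi - l q.2 zi| else 0.
wlog lt_kk' : k k' kk' / (k < k')%N.
  move=> h; have [lt|lt|e] := ltngtP k k'; first exact: h.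
    by rewrite distrC; apply: h => //; rewrite eq_sym.
  by move: kk'; rewrite (val_inj e) eqxx.
suff [_] : is_maximum [set t | exists k k' : 'I_K,
    (k < k')%N /\ t = `|l k zi - l k' zi|] (R_const l zi).
  by apply; exists k, k'.
apply: maximumP.
have [q _ qmax] := arg_maxP f (erefl : xpredT (k, k')).
have [q12|q12] := boolP (q.1 < q.2)%N.
  exists (f q); split; first by exists q.1, q.2; rewrite /f q12.
  move=> _ [j [j' [jj' ->]]].
  by have := qmax (j, j') isT; rewrite /f /= jj'.
(* Here the maximum of [f] is the default 0, so no increasing pair exceeds 0 and [(k, k')] is itself
   maximal. *)
exists (f (k, k')); split; first by exists k, k'; rewrite /f /= lt_kk'.
move=> _ [j [j' [jj' ->]]].
have : f (j, j') <= f q := qmax (j, j') isT.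
rewrite {1}/f /= jj' => /le_trans; apply.
by rewrite /f (negbTE q12) /= lt_kk'.
Qed.

(** The loss [d * (l k (zi + v) - l k' zi)] is split by inserting [l k zi]: the difference at [zi]
    is bounded by [R_const], the increment of [l k] by [E]. Only [E] will distinguish the two cases
    of [p]. *)
Lemma Phi_increment_le (k1 k2 : 'I_K) (b E : R) (a a' : R * R) : 0 <= b ->
  (k1 < k2)%N ->
  0 < a.1 -> 0 < a.2 -> a.1 + a.2 = 1 ->
  0 < a'.1 -> 0 < a'.2 -> a'.1 + a'.2 = 1 ->
  (forall k v, Z (zi + v) -> `|a.1 - a'.1| * c (zi + v) zi <= b ->
     `|a.1 - a'.1| * (l k (zi + v) - l k zi) <= E) ->
  Phi Z c l zi k1 k2 b a - Phi Z c l zi k1 k2 b a' <=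
    R_const l zi * `|a.1 - a'.1| + E.
Proof.
move=> b0 k12 a1 a2 a12 a'1 a'2 a'12 hE.
have kk : k1 != k2 by apply: contraTN k12 => /eqP ->; rewrite ltnn.
have [[[v1 v2] /= [[Z1 Z2] cb ->]] _] := Phi_attained k1 k2 b0 a1 a2.
have [_ ub'] := Phi_attained k1 k2 b0 a'1 a'2.
have g1 := cost_ge0 hc Z1 Zzi; have g2 := cost_ge0 hc Z2 Zzi.
have Rk := R_constP kk; move: Rk; rewrite ler_norml => /andP[Rk1 Rk2].
have [le_a|lt_a] := leP a.1 a'.1.
(* The first weight grows: [v1] is scaled down, and [v2], which loses weight [d], is kept. *)
- have dE : `|a.1 - a'.1| = a'.1 - a.1 by rewrite distrC ger0_norm// subr_ge0.
  rewrite dE in hE *; set d := a'.1 - a.1 in hE *.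
  have d0 : 0 <= d by rewrite subr_ge0.
  have a2E : a.2 = a'.2 + d by rewrite /d; lra.
  have [v1' [Z1' c1' l1']] := rescale_displacement k1 a1 le_a Z1.
  have c1 := mulr_ge0 (ltW a1) g1; have c2 := mulr_ge0 (ltW a'2) g2.
  have cd := mulr_ge0 d0 g2.
  have fe : a'.1 * c (zi + v1') zi + a'.2 * c (zi + v2) zi <= b.
    by move: cb; rewrite a2E mulrDl; lra.
  have := ub' (v1', v2) (conj Z1' Z2) fe => /= ub.
  have : d * (l k2 (zi + v2) - l k2 zi) <= E.
    by apply: hE => //; move: cb; rewrite a2E mulrDl; lra.
  have : d * (l k2 zi - l k1 zi) <= d * R_const l zi by rewrite ler_wpM2l//; lra.
  by move: l1'; rewrite -/d a2E; lra.
(* The mirror case: [v2] is scaled down and [v1] is kept. *)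
- have dE : `|a.1 - a'.1| = a.1 - a'.1 by rewrite ger0_norm// subr_ge0 ltW.
  rewrite dE in hE *; set d := a.1 - a'.1 in hE *.
  have d0 : 0 <= d by rewrite subr_ge0 ltW.
  have a1E : a.1 = a'.1 + d by rewrite /d; lra.
  have le_a2 : a.2 <= a'.2 by lra.
  have dE2 : a'.2 - a.2 = d by rewrite /d; lra.
  have [v2' [Z2' c2' l2']] := rescale_displacement k2 a2 le_a2 Z2.
  have c1 := mulr_ge0 (ltW a'1) g1; have c2 := mulr_ge0 (ltW a2) g2.
  have cd := mulr_ge0 d0 g1.
  have fe : a'.1 * c (zi + v1) zi + a'.2 * c (zi + v2') zi <= b.
    by move: cb; rewrite a1E mulrDl; lra.
  have := ub' (v1, v2') (conj Z1 Z2') fe => /= ub.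
  have : d * (l k1 (zi + v1) - l k1 zi) <= E.
    by apply: hE => //; move: cb; rewrite a1E mulrDl; lra.
  have : d * (l k1 zi - l k2 zi) <= d * R_const l zi by rewrite ler_wpM2l//; lra.
  by move: l2'; rewrite dE2 a1E; lra.
Qed.

Lemma Phi_modulus (k1 k2 : 'I_K) (b E : R) (a a' : R * R) : 0 <= b ->
  (k1 < k2)%N ->
  [/\ 0 < a.1, 0 < a.2 & a.1 + a.2 = 1] ->
  [/\ 0 < a'.1, 0 < a'.2 & a'.1 + a'.2 = 1] ->
  (forall k v, Z (zi + v) -> `|a.1 - a'.1| * c (zi + v) zi <= b ->
     `|a.1 - a'.1| * (l k (zi + v) - l k zi) <= E) ->
  `|Phi Z c l zi k1 k2 b a - Phi Z c l zi k1 k2 b a'| <=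
    R_const l zi * `|a.1 - a'.1| + E.
Proof.
move=> b0 k12 [a1 a2 a12] [a'1 a'2 a'12] hE.
rewrite ler_norml lerNl opprB Phi_increment_le// andbT distrC.
by apply: Phi_increment_le => //; rewrite distrC.
Qed.

End local_problem.

(** * Real powers *)

Section powers.
Variable R : realType.
Implicit Types x y r d b : R.

(** A fraction $u/(x+y)$ in $(0,1]$ is at most its $r$-th power; multiply by $(x+y)^r$ and add the
    cases $u=x$ and $u=y$. *)
Lemma powR_subadditive x y r : 0 <= x -> 0 <= y -> 0 <= r <= 1 ->
  (x + y) `^ r <= x `^ r + y `^ r.
Proof.
move=> x0 y0 /andP[r0 r1].
have [->|xn] := eqVneq x 0; first by rewrite add0r lerDr powR_ge0.
have [->|yn] := eqVneq y 0; first by rewrite addr0 lerDl powR_ge0.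
have xp : 0 < x by rewrite lt_neqAle eq_sym xn.
have yp : 0 < y by rewrite lt_neqAle eq_sym yn.
have s0 : 0 < x + y by rewrite addr_gt0.
have part (u : R) : 0 < u -> u <= x + y -> u / (x + y) * (x + y) `^ r <= u `^ r.
  move=> u0 us.
  have u01 : 0 < u / (x + y) <= 1 by rewrite divr_gt0//= ler_pdivrMr// mul1r.
  have uE : u = u / (x + y) * (x + y) by rewrite divfK// gt_eqF.
  rewrite [in leRHS]uE powRM ?(ltW s0)//; last first.
    by case/andP: u01 => /ltW.
  by rewrite ler_wpM2r ?powR_ge0// ger1_powR.
have := lerD (part x xp _) (part y yp _).
rewrite -mulrDl -mulrDl divff ?gt_eqF// mul1r; apply.
  by rewrite lerDl.
by rewrite lerDr.
Qed.

Lemma mulr_powR_div d b r : 0 < d -> 0 <= b ->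
  d * (b / d) `^ r = b `^ r * d `^ (1 - r).
Proof.
move=> d0 b0; rewrite powRM// ?invr_ge0 ?(ltW d0)//.
have -> : d^-1 `^ r = d `^ (- r).
  by rewrite -(powR_inv1 (ltW d0)) -powRrM mulN1r.
rewrite mulrCA; congr (_ * _).
rewrite -{1}(powRr1 (ltW d0)) -powRD//.
by apply/implyP => _; rewrite gt_eqF.
Qed.

End powers.

(** * The two bounds, by growth condition and by supergradients *)

Theorem lemma10 (R : realType) (n m K N : nat)
    (X : set 'rV[R]_n) (Z : set 'rV[R]_m)
    (c : 'rV[R]_m -> 'rV[R]_m -> R)
    (ell : 'I_K -> 'rV[R]_n -> 'rV[R]_m -> R)
    (zhat : 'I_N -> 'rV[R]_m) (rho : R)
    (nrm : 'rV[R]_m -> R) (p : R)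
    (hc : transport_cost Z c)
    (hzhat : forall i, Z (zhat i))
    (hrho : 0 < rho)
    (hreg : regularity X Z c ell zhat rho nrm p)
    (x : 'rV[R]_n) (hx : X x)
    (horacle : local_worst_case_oracle Z c (fun k => ell k x))
    (i : 'I_N) (k1 k2 : 'I_K) (hk : (k1 < k2)%N)
    (b : R) (hb : 0 <= b)
    (alpha alpha' : R * R)
    (halpha : [/\ 0 < alpha.1, 0 < alpha.2 & alpha.1 + alpha.2 = 1])
    (halpha' : [/\ 0 < alpha'.1, 0 < alpha'.2 & alpha'.1 + alpha'.2 = 1]) :
  let l := fun k => ell k x in
  let Phi_i := Phi Z c l (zhat i) k1 k2 b in
  let R_i := R_const l (zhat i) in
  let d := `|alpha.1 - alpha'.1| in
  (p = 1 -> forall (g : R) (z0 : 'rV[R]_m) (r : R),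
     growth_condition Z ell nrm x g z0 r ->
     `|Phi_i alpha - Phi_i alpha'| <=
       (R_i + 2 * C_const l (zhat i) nrm g z0 r) * d
       + 2 * g * b `^ r * d `^ (1 - r)) /\
  (1 < p ->
     `|Phi_i alpha - Phi_i alpha'| <=
       R_i * d
       + 2 * G_const l (zhat i) nrm * b `^ p^-1 * d `^ (1 - p^-1)).
Proof.
move=> l Phi_i R_i d.
have Zzi : Z (zhat i) := hzhat i.
have hn := reg_norm hreg.
have p_ge1 := reg_p hreg.
have hl k : concave_function (l k) := reg_concave hreg k x.
have lip E := @Phi_modulus R m K Z c l nrm p (zhat i) hc hn p_ge1
  (reg_Zclosed hreg) (reg_Zconvex hreg) hl (reg_cost hreg) Zzi k1 k2 b E
  alpha alpha' hb hk halpha halpha'.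
have d_ge0 : 0 <= d by exact: normr_ge0.
have norm_le v : 0 < d -> Z (zhat i + v) -> d * c (zhat i + v) (zhat i) <= b ->
    nrm v <= (b / d) `^ p^-1.
  move=> d0 Zv; rewrite mulrC -ler_pdivlMr// => cv.
  by apply: (norm_le_cost hn p_ge1 (reg_cost hreg)) cv => //; rewrite divr_ge0.
split=> [p1 g z0 r [g0 Zz0 /andP[r0 r1] growth]|p_gt1].
- set C := C_const l (zhat i) nrm g z0 r.
  have Ck k : g + g * nrm (zhat i - z0) `^ r - l k (zhat i) <= C.
    have [_] := fin_maximumP
      (fun k => g + g * nrm (zhat i - z0) `^ r - l k (zhat i)) k.
    by apply; exists k.
  have lk k z : Z z -> l k z <= g * (1 + nrm (z - z0) `^ r).
    move=> /growth; apply: le_trans.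
    by have [_] := fin_maximumP (fun k => ell k x z) k; apply; exists k.
  (* The growth condition at [zhat i] itself makes a term of the maximum [C] nonnegative. *)
  have C0 : 0 <= C.
    by apply: le_trans (Ck k1); have := lk k1 _ Zzi; lra.
  have T0 : 0 <= g * (b `^ r * d `^ (1 - r)).
    by rewrite !mulr_ge0 ?powR_ge0// ltW.
  (* [E] contains [C * d] and the power term once; both are nonnegative, so the doubled terms of the
     claim dominate. *)
  apply: le_trans (lip (C * d + g * (b `^ r * d `^ (1 - r))) _) _; last first.
    rewrite -/d -/R_i; have := mulr_ge0 C0 d_ge0.
    by rewrite -[2 * g * _ * _]mulrA -[2 * g * _]mulrA; lra.
  rewrite -/d => k v Zv cv.
  (* For [d = 0] the radius [b / d] has no meaning, but the left side vanishes. *)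
  have [d0|d0] := eqVneq d 0; first by rewrite d0 in T0 *; rewrite mul0r mulr0 add0r.
  have {}d0 : 0 < d by rewrite lt_neqAle eq_sym d0.
  have nv := norm_le v d0 Zv cv.
  have bd0 : 0 <= b / d by rewrite divr_ge0.
  rewrite p1 invr1 powRr1// in nv.
  (* Dividing by [d] leaves $\ell_k(\hat z_i+v)-\ell_k(\hat z_i)\le C+g(b/d)^r$. *)
  rewrite -mulr_powR_div// mulrCA [C * d]mulrC -mulrDr ler_pM2l//.
  have nr : nrm (zhat i + v - z0) `^ r <= nrm (zhat i - z0) `^ r + (b / d) `^ r.
    apply: (@le_trans _ _ ((nrm (zhat i - z0) + b / d) `^ r)).
      apply: ge0_ler_powR; rewrite ?nnegrE ?is_norm_ge0 ?addr_ge0 ?is_norm_ge0//.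
      by rewrite addrAC; apply: le_trans (is_normD hn _ _) _; rewrite lerD2l.
    by apply: powR_subadditive; rewrite ?is_norm_ge0// r0 ltW.
  have := lk k _ Zv; have := Ck k; rewrite -(ler_pM2l g0) in nr; lra.
- set G := G_const l (zhat i) nrm.
  have GP k := @G_constP R m K l nrm (zhat i) k hn hl.
  have [G0 _] := GP k1; rewrite -/G in G0.
  have T0 : 0 <= G * (b `^ p^-1 * d `^ (1 - p^-1)).
    by rewrite !mulr_ge0 ?powR_ge0.
  (* For [d > 0] this [E] is $d\,G\,(b/d)^{1/p}$, the supergradient bound at the largest possible
     displacement norm. *)
  apply: le_trans (lip (G * (b `^ p^-1 * d `^ (1 - p^-1))) _) _; last first.
    rewrite -/d -/R_i -[2 * G * _ * _]mulrA -[2 * G * _]mulrA; lra.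
  rewrite -/d => k v Zv cv.
  have [d0|d0] := eqVneq d 0; first by rewrite d0 in T0 *; rewrite mul0r.
  have {}d0 : 0 < d by rewrite lt_neqAle eq_sym d0.
  have [_ /(_ v) lv] := GP k; rewrite -/G in lv.
  rewrite -mulr_powR_div// mulrCA ler_pM2l//; apply: le_trans lv _.
  by rewrite ler_wpM2l// norm_le.
Qed.
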